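(* Let $T \in L(\omega)$. The following statements are equivalent. (1) $T$ does not possess a closed almost-invariant half-space. (2) $T$ does not possess a closed invariant half-space. (3) There exist $\lambda \in \mathbb{C}$ and an operator $R \in L(\omega)$ of finite rank such that $T$ is conjugate to $B + \lambda \operatorname{Id} + R$ or to $F + \lambda \operatorname{Id} + R$.
   Context: $\omega = \mathbb{C}^{\mathbb{Z}_+}$ ($\mathbb{Z}_+$ the non-negative integers) is the Fréchet space of all complex sequences, with topology given by the seminorms $p_j(x) = \max_{0\le n \le j}|x_n|$, $j \ge 0$; $L(\omega)$ is the set of continuous linear maps (operators) $\omega \to \omega$. The Forward shift $F$ and the Backward shift $B$ on $\omega$ are $F(x_0,x_1,x_2,\ldots) = (0,x_0,x_1,\ldots)$ and $B(x_0,x_1,x_2,\ldots) = (x_1,x_2,x_3,\ldots)$. A half-space is a linear subspace of $\omega$ of infinite dimension and infinite codimension. A subspace $M$ is invariant for $T$ if $T(M)\subseteq M$, and almost-invariant for $T$ if there is a finite rank operator $R \in L(\omega)$ with $(T+R)(M)\subseteq M$. $T$ is conjugate to $S$ if there is an invertible operator $P \in L(\omega)$ with $T = P^{-1}SP$. *)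

(* Defs.v *)
From HB Require Import structures.
From mathcomp Require Import all_boot all_order all_algebra.
From mathcomp Require Import all_classical all_reals topology normedtype.
From mathcomp Require Import complex.

Set Implicit Arguments.
Unset Strict Implicit.
Unset Printing Implicit Defensive.
Set Warnings "-redundant-canonical-projection".

Import Order.TTheory GRing.Theory Num.Theory.
Import numFieldNormedType.Exports.

Local Open Scope classical_set_scope.
Local Open Scope ring_scope.

Section LinearSpaces.
Variables (K : fieldType) (V : lmodType K).
Implicit Types M : set V.

Definition linear_subspace M : Prop := submod_closed (mem M).

Definition linear_span (n : nat) (v : 'I_n -> V) : set V :=
  [set x | exists c : 'I_n -> K, x = \sum_(i < n) c i *: v i].

Definition finite_dim M : Prop :=
  exists (n : nat) (v : 'I_n -> V), M = linear_span v.

(* The quotient space V / M is spanned by the classes of finitely many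
   vectors. *)
Definition finite_codim M : Prop :=
  exists (n : nat) (v : 'I_n -> V),
    forall x, exists2 y, linear_span v y & M (x - y).

Definition half_space M : Prop :=
  [/\ linear_subspace M, ~ finite_dim M & ~ finite_codim M].

End LinearSpaces.

(* The complex numbers R[i]; naming the numClosedFieldType gives them the
   topology of the norm, which is only attached to numeric field structures. *)
Definition Cfield (R : realType) : numClosedFieldType := R[i]%C.

(* Sequences of complex numbers, with the topology of pointwise convergence;
   [nbhs_omegaP] below shows that it is the topology of the seminorms
   [omega_seminorm j]. *)
Definition omega (R : realType) := {ptws nat -> Cfield R}.

HB.instance Definition _ (R : realType) := Uniform.on (omega R).
HB.instance Definition _ (R : realType) :=
  GRing.Lmodule.copy (omega R) (nat -> (Cfield R)^o).

(* Without this instance, the search for [ProperFilter (nbhs x)] does not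
   terminate on product topologies. *)
#[global] Instance omega_nbhs_pfilter (R : realType) (x : omega R) :
  ProperFilter (nbhs x).
Proof. exact: nbhs_pfilter. Qed.

(* Its values are nonnegative reals, as elements of [Cfield R]. *)
Definition omega_seminorm (R : realType) (j : nat) (x : omega R) : Cfield R :=
  \big[Num.max/0]_(n < j.+1) `|x n|.

Lemma omega_seminorm_lt (R : realType) (j : nat) (x : omega R) (e : Cfield R) :
  0 < e ->
  omega_seminorm j x < e <-> forall n, (n <= j)%N -> `|x n| < e.
Proof.
move=> e0; rewrite /omega_seminorm.
suff H m (u : nat -> Cfield R) : (0 <= \big[Num.max/0]_(n < m) `|u n|) /\
    (\big[Num.max/0]_(n < m) `|u n| < e <-> forall n, (n < m)%N -> `|u n| < e).
  exact: (H j.+1 x).2.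
elim: m u => [|m IH] u; first by rewrite big_ord0; split.
have [/= s0 IHs] := IH (u \o succn).
have cmp : `|u 0| >=< \big[Num.max/0]_(n < m) `|u n.+1|.
  by rewrite real_comparable ?ger0_real.
rewrite big_ord_recl /=; split; first by rewrite comparable_le_max // normr_ge0.
rewrite comparable_gt_max //; split=> [/andP[u0 /IHs us] [//|n]|us].
  exact: us.
by rewrite us //=; apply/IHs => n nm; apply: us.
Qed.

Lemma nbhs_omegaP (R : realType) (x : omega R) (A : set (omega R)) :
  nbhs x A <-> exists (j : nat) (e : Cfield R),
    0 < e /\ [set y | omega_seminorm j (y - x) < e] `<=` A.
Proof.
split; last first.
  move=> [j [e [e0 eA]]]; apply: (filterS eA).
  pose U (n : 'I_j.+1) := [set y : omega R | `|y n - x n| < e].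
  have : nbhs x [set y | forall n, U n y].
    apply: (@filter_forall _ _ U (nbhs x)) => n.
    have /= := @proj_continuous _ (fun=> Cfield R) (n : nat) x.
    move/cvgr_dist_lt => /(_ e e0); apply: filterS => y.
    by rewrite distrC.
  apply: filterS => y H; apply/omega_seminorm_lt => // n nj.
  exact: (H (Ordinal (nj : (n < j.+1)%N))).
pose D := [set p : nat * Cfield R | 0 < p.2].
pose B p := [set y : omega R | omega_seminorm p.1 (y - x) < p.2].
have Ffilter : Filter (filter_from D B).
  apply: filter_from_filter; first by exists (0%N, 1) => /=; exact: ltr01.
  move=> [j e] [k d] /= e0 d0.
  have ed : e >=< d by rewrite real_comparable ?gtr0_real.
  have m0 : 0 < Num.min e d by rewrite comparable_lt_min ?e0.
  exists (maxn j k, Num.min e d) => // y /= /omega_seminorm_lt -/(_ m0) H.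
  split; apply/omega_seminorm_lt => // n nj; move: (H n).
    rewrite comparable_lt_min // => /(_ (leq_trans nj (leq_maxl _ _))).
    by case/andP.
  rewrite comparable_lt_min // => /(_ (leq_trans nj (leq_maxr _ _))).
  by case/andP.
have cvgF : {ptws, filter_from D B --> x}.
  apply/pointwise_cvgP => n; apply/cvgrPdist_lt => e e0.
  exists (n, e) => // y /omega_seminorm_lt -/(_ e0 n (leqnn n)).
  by rewrite distrC.
by move/cvgF => [[j e] /= e0 BA]; exists j, e.
Qed.

(* Membership in L(omega). *)
Definition operator (R : realType) (T : omega R -> omega R) : Prop :=
  linear T /\ continuous T.

Definition finite_rank (R : realType) (T : omega R -> omega R) : Prop :=
  finite_dim (range T).

Definition forward_shift (R : realType) (x : omega R) : omega R :=
  fun n => if n is k.+1 then x k else 0.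

Definition backward_shift (R : realType) (x : omega R) : omega R :=
  fun n => x n.+1.

Lemma forward_shift_operator (R : realType) : operator (@forward_shift R).
Proof.
split.
  move=> a x y; apply/funext => -[|n] //.
  by change (0 = a * 0 + 0 :> Cfield R); rewrite mulr0 addr0.
move=> x; apply/pointwise_cvgP => -[|n].
  exact: (@cvg_cst (Cfield R) 0 (omega R) (nbhs x)).
exact: (@proj_continuous _ (fun=> Cfield R) n x).
Qed.

Lemma backward_shift_operator (R : realType) : operator (@backward_shift R).
Proof.
split=> // x; apply/pointwise_cvgP => n.
exact: (@proj_continuous _ (fun=> Cfield R) n.+1 x).
Qed.

Definition invariant_for (R : realType) (T : omega R -> omega R)
    (M : set (omega R)) : Prop :=
  T @` M `<=` M.

Definition almost_invariant_for (R : realType) (T : omega R -> omega R)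
    (M : set (omega R)) : Prop :=
  exists S : omega R -> omega R,
    [/\ operator S, finite_rank S & invariant_for (T \+ S) M].

Definition conjugate_to (R : realType) (T S : omega R -> omega R) : Prop :=
  exists P Pinv : omega R -> omega R,
    [/\ operator P, operator Pinv, cancel P Pinv, cancel Pinv P
      & T = Pinv \o S \o P].

(* Main.v *)
(* The polynomials are the continuous dual of [omega], and the closed subspaces of
   [omega] are the annihilators of arbitrary subspaces of polynomials; so (2) => (3)
   is a statement about a linear endomorphism A of a space of countable dimension
   all of whose invariant subspaces are of finite dimension or codimension. If some
   v satisfies p(A)v <> 0 for all p <> 0, the span of the A^n v has finite
   codimension, and A is a forward shift up to finite rank. Otherwise A is locally
   algebraic; its eigenvectors span a finite-dimensional space (alternate members of
   an independent sequence of eigenvectors would span an invariant half-space), and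
   this Artinian condition gives a nonzero invariant subspace on which some A - a is
   surjective with a nonzero kernel, hence an infinite chain (A - a) u_(n+1) = u_n,
   (A - a) u_0 = 0, on whose span A - a is a backward shift. Passing to adjoints
   exchanges the two shifts.

   For (3) => (1), a finite-rank operator vanishes on the sequences whose first d
   terms are zero. A closed invariant subspace of infinite dimension for F + S
   contains such a sequence x <> 0, hence all F^k x and their closed span. Dually, a
   closed invariant subspace of infinite codimension for B + S is annihilated by a
   polynomial of large degree, hence by polynomials of every larger degree. *)

From HB Require Import structures.
Require Import Defs.
From mathcomp Require Import all_boot all_order all_algebra.
From mathcomp Require Import all_classical all_reals topology normedtype.
From mathcomp Require Import complex.

Set Implicit Arguments.
Unset Strict Implicit.
Unset Printing Implicit Defensive.

Import Order.TTheory GRing.Theory Num.Theory.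
Import numFieldNormedType.Exports.

Local Open Scope classical_set_scope.
Local Open Scope ring_scope.

(** * Linear independence and dimension *)

Section Subspaces.
Variables (K : fieldType) (V : lmodType K).
Implicit Types (M N E W G : set V) (b c : nat -> V) (p q : {poly K}).

Lemma linear_subspaceP M : linear_subspace M <->
  M 0 /\ forall (a : K) x y, M x -> M y -> M (a *: x + y).
Proof.
split=> -[M0 ML]; split.
- by move: M0; rewrite in_setE.
- move=> a x y Mx My; rewrite -in_setE; apply: ML; rewrite in_setE //.
- by rewrite in_setE.
- by move=> a x y; rewrite !in_setE; apply: ML.
Qed.

Lemma subspace0 M : linear_subspace M -> M 0.
Proof. by case/linear_subspaceP. Qed.

Lemma subspaceP M a x y : linear_subspace M -> M x -> M y -> M (a *: x + y).
Proof. by case/linear_subspaceP => _; apply. Qed.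

Lemma subspaceD M x y : linear_subspace M -> M x -> M y -> M (x + y).
Proof. by move=> sM Mx My; rewrite -[x]scale1r; apply: subspaceP. Qed.

Lemma subspaceZ M a x : linear_subspace M -> M x -> M (a *: x).
Proof.
by move=> sM Mx; rewrite -[_ *: _]addr0; apply: subspaceP => //; apply: subspace0.
Qed.

Lemma subspaceB M x y : linear_subspace M -> M x -> M y -> M (x - y).
Proof. by move=> sM Mx My; rewrite addrC -scaleN1r; apply: subspaceP. Qed.

Lemma subspace_sum M n (F : 'I_n -> V) :
  linear_subspace M -> (forall i, M (F i)) -> M (\sum_(i < n) F i).
Proof.
move=> sM MF; apply: (big_ind M); [exact: subspace0 | |by []].
by move=> x y; apply: subspaceD.
Qed.

Lemma subspaceI M N :
  linear_subspace M -> linear_subspace N -> linear_subspace (M `&` N).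
Proof.
move=> sM sN; apply/linear_subspaceP; split; first by split; apply: subspace0.
by move=> a x y [Mx Nx] [My Ny]; split; apply: subspaceP.
Qed.

Lemma linear_spanP n b x :
  linear_span (fun i : 'I_n => b i) x <->
  exists c : nat -> K, x = \sum_(i < n) c i *: b i.
Proof.
split=> -[c ->]; last by exists (fun i : 'I_n => c i).
exists (fun k => if insub k is Some i then c i else 0).
by apply: eq_bigr => i _; rewrite insubT // => ?; congr (c _ *: _); apply/val_inj.
Qed.

Lemma ord_fun_nat n (v : 'I_n -> V) :
  exists b, v = fun i : 'I_n => b i.
Proof.
exists (fun k => if insub k is Some i then v i else 0).
by apply/funext => i; rewrite insubT // => ?; congr v; apply/val_inj.
Qed.

Lemma linear_span_subspace n (v : 'I_n -> V) : linear_subspace (linear_span v).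
Proof.
apply/linear_subspaceP; split.
  by exists (fun=> 0); rewrite big1 // => i _; rewrite scale0r.
move=> a _ _ [c ->] [d ->]; exists (fun i => a * c i + d i).
rewrite scaler_sumr -big_split; apply: eq_bigr => i _ /=.
by rewrite scalerA scalerDl.
Qed.

Lemma mem_linear_span n (v : 'I_n -> V) i : linear_span v (v i).
Proof.
exists (fun j => (i == j)%:R); rewrite (bigD1 i) //= eqxx scale1r big1 ?addr0 //.
by move=> j /negPf; rewrite eq_sym => ->; rewrite scale0r.
Qed.

Lemma linear_span_sub M n (v : 'I_n -> V) :
  linear_subspace M -> (forall i, M (v i)) -> linear_span v `<=` M.
Proof.
move=> sM Mv x [c ->]; apply: subspace_sum => // i; exact: subspaceZ.
Qed.

Lemma finite_codim_sub M N : M `<=` N -> finite_codim M -> finite_codim N.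
Proof.
by move=> MN [n [v vM]]; exists n, v => x; have [y ? /MN] := vM x; exists y.
Qed.

(** Polynomials serve as finitely supported coefficient sequences: [lcomb b] is injective when [b]
    is linearly independent, and bijective when [b] is a basis. *)
Definition lcomb b p : V := \sum_(i < size p) p`_i *: b i.

Lemma lcomb_widen n b p : (size p <= n)%N -> lcomb b p = \sum_(i < n) p`_i *: b i.
Proof.
move=> pn; rewrite /lcomb (big_ord_widen n (fun i => p`_i *: b i)) //.
rewrite big_mkcond; apply: eq_bigr => i _ /=; case: ltnP => // pi.
by rewrite nth_default // scale0r.
Qed.

Fact lcomb_is_linear b : linear (lcomb b).
Proof.
move=> a p q; set n := maxn (size p) (size q).
rewrite (@lcomb_widen n b p) ?leq_maxl // (@lcomb_widen n b q) ?leq_maxr //.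
rewrite (@lcomb_widen n).
  rewrite scaler_sumr -big_split; apply: eq_bigr => i _ /=.
  by rewrite coefD coefZ scalerDl scalerA.
apply: leq_trans (size_polyD _ _) _.
by rewrite geq_max leq_maxr (leq_trans (size_scale_leq _ _)) ?leq_maxl.
Qed.

HB.instance Definition _ b :=
  GRing.isLinear.Build K {poly K} V _ (lcomb b) (lcomb_is_linear b).

Lemma lcombXn b n : lcomb b 'X^n = b n.
Proof.
rewrite /lcomb size_polyXn big_ord_recr /= coefXn eqxx scale1r big1 ?add0r //.
by move=> i _; rewrite coefXn ltn_eqF // scale0r.
Qed.

Lemma lcombC b a : lcomb b a%:P = a *: b 0%N.
Proof. by rewrite -[a%:P]mulr1 mul_polyC linearZ /= -(lcombXn b 0). Qed.

Lemma lcombMX b p : lcomb b (p * 'X) = lcomb (b \o succn) p.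
Proof.
rewrite (@lcomb_widen (size p).+1).
  by rewrite big_ord_recl coefMX /= scale0r add0r; apply: eq_bigr => i _; rewrite coefMX.
by apply: leq_trans (size_polyMleq _ _) _; rewrite size_polyX addn2.
Qed.

Lemma subspace_lcomb M b p :
  linear_subspace M -> (forall i, M (b i)) -> M (lcomb b p).
Proof. by move=> sM Mb; apply: subspace_sum => // i; apply: subspaceZ. Qed.

Lemma lcomb_range_subspace b : linear_subspace (range (lcomb b)).
Proof.
apply/linear_subspaceP; split; first by exists 0; rewrite ?linear0.
by move=> a _ _ [p _ <-] [q _ <-]; exists (a *: p + q); rewrite ?linearP.
Qed.

Lemma lcomb_inj b :
  (forall p, lcomb b p = 0 -> p = 0) -> injective (lcomb b).
Proof.
move=> b0 p q epq; apply/eqP; rewrite -subr_eq0; apply/eqP/b0.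
by rewrite linearB /= epq subrr.
Qed.

Lemma lcomb_inj0 b p : injective (lcomb b) -> lcomb b p = 0 -> p = 0.
Proof. by move=> bI bp; apply: bI; rewrite bp linear0. Qed.

(* Greedy choice of vectors of [G] outside the span of the previous ones. *)
Lemma independent_or_spanned G :
  (exists b, injective (lcomb b) /\ forall n, G (b n)) \/
  (exists n (v : 'I_n -> V), (forall i, G (v i)) /\ G `<=` linear_span v).
Proof.
have [?|noS] := pselect (exists n (v : 'I_n -> V),
  (forall i, G (v i)) /\ G `<=` linear_span v); [by right|left].
have /choice[g gP] : forall s : seq V, exists x, (forall i, (i < size s)%N -> G s`_i) ->
    G x /\ ~ linear_span (fun i : 'I_(size s) => s`_i) x.
  move=> s; have [sG|] := pselect (forall i, (i < size s)%N -> G s`_i); last by exists 0.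
  apply: contrapT => no; apply: noS; exists (size s), (fun i : 'I_(size s) => s`_i).
  split=> [i|x Gx]; first exact: sG.
  by apply: contrapT => nx; apply: no; exists x.
pose pre := fix pre n := if n is k.+1 then rcons (pre k) (g (pre k)) else [::].
pose b n := g (pre n).
have preE n : pre n = mkseq b n by elim: n => //= n nE; rewrite mkseqS -nE.
have bG n : G (b n) /\ ~ linear_span (fun i : 'I_n => b i) (b n).
  elim/ltn_ind: n => n IH; rewrite {1 3}/b preE.
  have [|Gg ng] := gP (mkseq b n).
    rewrite size_mkseq => i ni; rewrite nth_mkseq //; exact: (IH i ni).1.
  split=> // -/linear_spanP[c gE]; apply: ng.
  apply/(@linear_spanP _ (nth 0 (mkseq b n))); exists c; rewrite gE size_mkseq.
  by apply: eq_bigr => i _; rewrite nth_mkseq.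
exists b; split; last by move=> n; case: (bG n).
apply: lcomb_inj => p bp; apply/eqP/negPn/negP => p0.
have sp : size p = (size p).-1.+1 by rewrite prednK // size_poly_gt0.
have [_] := bG (size p).-1; apply; apply/linear_spanP.
exists (fun i => - (lead_coef p)^-1 * p`_i).
move: bp; rewrite /lcomb sp big_ord_recr /= -lead_coefE.
move/eqP; rewrite addrC addr_eq0 => /eqP e.
rewrite -[LHS]scale1r -(mulVf (_ : lead_coef p != 0)) ?lead_coef_eq0 //.
rewrite -scalerA e scalerN -scaleNr scaler_sumr.
by apply: eq_bigr => i _; rewrite scalerA.
Qed.

(** Modulo [E], the [n + 1] vectors [b 0], ..., [b n] lie in the span of [n] vectors; a nonzero row
    in the left kernel of the coefficient matrix gives [p]. *)
Lemma dependent_mod E n (v : 'I_n -> V) b : linear_subspace E ->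
  (forall i, exists2 y, linear_span v y & E (b i - y)) ->
  exists2 p, p != 0 & E (lcomb b p).
Proof.
move=> sE bE.
have /choice[f fE] : forall i, exists c : 'I_n -> K, E (b i - \sum_(j < n) c j *: v j).
  by move=> i; have [_ [c ->]] := bE i; exists c.
pose A : 'M[K]_(n.+1, n) := \matrix_(i, j) f i j.
have /rowV0Pn[u /sub_kermxP uA u0] : kermx A != 0.
  by rewrite kermx_eq0 /row_free eqn_leq negb_and -!ltnNge ltnS rank_leq_col orbT.
pose p := \poly_(i < n.+1) u 0 (inord i).
have pE (i : 'I_n.+1) : p`_i = u 0 i by rewrite coef_poly ltn_ord inord_val.
exists p.
  apply: contraNneq u0 => p0; apply/eqP/rowP => i.
  by rewrite -pE p0 coef0 mxE.
rewrite (@lcomb_widen n.+1) ?size_poly //.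
have -> : \sum_(i < n.+1) p`_i *: b i =
    \sum_(i < n.+1) u 0 i *: (b i - \sum_(j < n) f i j *: v j).
  under [RHS]eq_bigr do rewrite scalerBr scaler_sumr.
  rewrite big_split /= sumrN exchange_big /= [X in _ - X]big1 ?subr0.
    by apply: eq_bigr => i _; rewrite pE.
  move=> j _; under eq_bigr do rewrite scalerA.
  rewrite -scaler_suml.
  have := congr1 (fun M : 'rV_n => M 0 j) uA; rewrite !mxE => e.
  rewrite (eq_bigr (fun i => u 0 i * A i j)) ?e ?scale0r // => i _.
  by rewrite mxE.
by apply: subspace_sum => // i; apply: subspaceZ.
Qed.

Lemma set0_subspace : linear_subspace [set 0 : V].
Proof.
by apply/linear_subspaceP; split=> //= a x y -> ->; rewrite scaler0 addr0.
Qed.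

Lemma independent_infinite b M : injective (lcomb b) -> (forall i, M (b i)) ->
  ~ finite_dim M.
Proof.
move=> bI bM [n [v Mv]].
have [|p /eqP p0 /= bp] := @dependent_mod [set 0] n v b set0_subspace.
  by move=> i; exists (b i); rewrite -?Mv //= subrr.
exact/p0/(lcomb_inj0 bI).
Qed.

Lemma infinite_independent M : linear_subspace M -> ~ finite_dim M ->
  exists b, injective (lcomb b) /\ forall n, M (b n).
Proof.
move=> sM Mi; have [//|[n [v [vM Mv]]]] := independent_or_spanned M.
by case: Mi; exists n, v; apply/seteqP; split => //; apply: linear_span_sub.
Qed.

Lemma infinite_meets_cofinite M E : linear_subspace M -> linear_subspace E ->
  ~ finite_dim M -> finite_codim E -> exists x, [/\ x != 0, M x & E x].
Proof.
move=> sM sE Mi [n [v vE]].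
have [b [bI bM]] := infinite_independent sM Mi.
have [//|p p0 bp] := @dependent_mod E n v b sE.
exists (lcomb b p); split=> //; last exact: subspace_lcomb.
by apply: contraNneq p0 => /(lcomb_inj0 bI) ->.
Qed.

Lemma finite_dim_sub M N : linear_subspace M -> M `<=` N -> finite_dim N ->
  finite_dim M.
Proof.
move=> sM MN Nf; apply: contrapT => /(infinite_independent sM)[b [bI bM]].
by case: (independent_infinite bI (fun i => MN _ (bM i))).
Qed.

(** Induction on the number of vectors spanning [W]. With the last one removed, the traces of [D k]
    on [W'] stabilise, and so does the truth of the inclusion of [D k] in [W']. Past both indices, a
    [y] in [D k] outside [W'] reduces every element of [D m] into [W']. *)
Lemma finite_dim_chain (D : nat -> set V) W : (forall k, linear_subspace (D k)) ->
  (forall k l, (k <= l)%N -> D l `<=` D k) -> finite_dim W -> D 0%N `<=` W ->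
  exists k0, forall k, (k0 <= k)%N -> D k0 `<=` D k.
Proof.
move=> sD dD [n [v ->]]; have [b -> {v}] := ord_fun_nat v.
elim: n D sD dD => [|n IH] D sD dD D0.
  exists 0%N => k _ x /D0 [c ->]; rewrite big_ord0; exact: subspace0.
pose W' := linear_span (fun i : 'I_n => b i).
have sW' : linear_subspace W' by exact: linear_span_subspace.
have [k1 k1P] : exists k0, forall k, (k0 <= k)%N -> D k0 `&` W' `<=` D k `&` W'.
  apply: (IH (fun k => D k `&` W')); [by move=> k; apply: subspaceI| |by move=> x []].
  by move=> k l kl x [/dD Dx ?]; split=> //; apply: Dx.
have [k2 k2P] : exists k0, forall k, (k0 <= k)%N -> D k `<=` W' -> D k0 `<=` W'.
  have [[k Dk]|no] := pselect (exists k, D k `<=` W'); first by exists k.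
  by exists 0%N => k _ Dk; case: no; exists k.
pose m := maxn k1 k2; exists m => k mk x Dx.
have W'P z : W' z -> D m z -> D k z.
  move=> W'z Dz; have [] // := k1P k (leq_trans (leq_maxl _ _) mk) z.
  split=> //; exact: (dD _ _ (leq_maxl k1 k2)).
have [Dk|/existsNP[y /not_implyP[Dy W'y]]] := pselect (D k `<=` W').
  apply: W'P => //; apply: (k2P k) => //; first exact: leq_trans (leq_maxr _ _) mk.
  exact: (dD _ _ (leq_maxr k1 k2)).
have dec z : D m z -> exists a, W' (z - a *: b n).
  move=> /(dD _ _ (leq0n _))/D0 /linear_spanP[c ->]; exists (c n).
  by rewrite big_ord_recr /= addrK; exists (fun i : 'I_n => c i).
have Dmy := dD _ _ mk _ Dy.
have [d W'd] := dec _ Dmy; have [e W'e] := dec _ Dx.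
have d0 : d != 0 by apply: contra_not_neq W'y => d0; rewrite d0 scale0r subr0 in W'd.
have -> : x = (e / d) *: y + (x - (e / d) *: y) by rewrite addrCA subrr addr0.
apply: subspaceP => //; apply: W'P; last by apply: subspaceB => //; apply: subspaceZ.
have -> : x - (e / d) *: y = (x - e *: b n) - (e / d) *: (y - d *: b n).
  by rewrite scalerBr scalerA divfK // opprB addrA subrK.
by apply: subspaceB => //; apply: subspaceZ.
Qed.

End Subspaces.

(** * Linear maps of infinite-dimensional spaces *)

Section FiniteDimension.
Variables (K : fieldType) (V : lmodType K).
Implicit Types (M N E W G : set V) (b c : nat -> V) (p q : {poly K}).

Lemma lcomb_linear (U : lmodType K) (f : {linear V -> U}) b p :
  f (lcomb b p) = lcomb (f \o b) p.
Proof. by rewrite /lcomb linear_sum; apply: eq_bigr => i _; rewrite linearZ. Qed.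

Lemma finite_dim_sum M N W : finite_dim M -> finite_dim N -> linear_subspace W ->
  (forall x, W x -> exists2 y, M y & N (x - y)) -> finite_dim W.
Proof.
move=> [m [v ->]] [n [w ->]] sW WP.
pose vw (i : 'I_(m + n)) := match fintype.split i with inl j => v j | inr j => w j end.
apply: (@finite_dim_sub _ _ _ (linear_span vw)) => //; last by exists (m + n)%N, vw.
move=> x /WP[y [c yE] [d xE]].
exists (fun i => match fintype.split i with inl j => c j | inr j => d j end).
rewrite -[x](subrK y) xE yE addrC big_split_ord /=; congr (_ + _);
  apply: eq_bigr => i _; rewrite /vw.
- by rewrite -[lshift _ _]/(unsplit (inl i)) unsplitK.
- by rewrite -[rshift _ _]/(unsplit (inr i)) unsplitK.
Qed.

Lemma preimage_subspace (U : lmodType K) (f : {linear V -> U}) (W : set U) :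
  linear_subspace W -> linear_subspace (f @^-1` W).
Proof.
move=> sW; apply/linear_subspaceP; split=> [|a x y Wx Wy] /=.
  by rewrite linear0; apply: subspace0.
by rewrite linearP; apply: subspaceP.
Qed.

Lemma image_subspace (U : lmodType K) (f : {linear V -> U}) (M : set V) :
  linear_subspace M -> linear_subspace (f @` M).
Proof.
move=> sM; apply/linear_subspaceP; split.
  by exists 0; rewrite ?linear0 //; apply: subspace0.
move=> a _ _ [x Mx <-] [y My <-]; exists (a *: x + y); rewrite ?linearP //.
exact: subspaceP.
Qed.

Lemma preimage_finite_dim (U : lmodType K) (f : {linear V -> U}) (W : set U) :
  linear_subspace W -> finite_dim W -> finite_dim [set x | f x = 0] ->
  finite_dim (f @^-1` W).
Proof.
move=> sW fW fk; pose X := W `&` range f.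
have [n [v Xv]] : finite_dim X.
  apply: finite_dim_sub fW; last by move=> x [].
  by apply: subspaceI => //; apply: image_subspace; apply/linear_subspaceP.
have /choice[u uE] : forall i, exists x, f x = v i.
  move=> i; have : X (v i) by rewrite Xv; apply: mem_linear_span.
  by case=> _ [x _]; exists x.
apply: (@finite_dim_sum (linear_span u) [set x | f x = 0]) => //.
- by exists n, u.
- exact: preimage_subspace.
move=> x Wfx; have : X (f x) by split=> //; exists x.
rewrite Xv => -[c fx]; exists (\sum_i c i *: u i); first by exists c.
rewrite /= linearB /= fx linear_sum /=; apply/eqP; rewrite subr_eq0; apply/eqP.
by apply: eq_bigr => i _; rewrite linearZ /= uE.
Qed.

(** Each [w i] is put in front of the family, or dropped if already in its span. The old family
    survives as a tail, so recurrences along [b] hold for [b'] from index [m] on. *)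
Lemma basis_completion n (w : nat -> V) b : injective (lcomb b) ->
  (forall x, exists c : nat -> K, range (lcomb b) (x - \sum_(i < n) c i *: w i)) ->
  exists m b', bijective (lcomb b') /\ forall k, b' (m + k)%N = b k.
Proof.
elim: n w b => [|n IH] w b bI wP.
  exists 0%N, b; split=> //; have /choice[g gP] : forall x, exists p, lcomb b p = x.
    by move=> x; have [c] := wP x; rewrite big_ord0 subr0 => -[p _ <-]; exists p.
  by exists g => // p; apply: bI.
have [w0|w0] := pselect (range (lcomb b) (w 0%N)).
  apply: (IH (w \o succn)) => // x; have [c cP] := wP x; exists (c \o succn).
  rewrite big_ord_recl in cP.
  have := subspaceP (c 0%N) (lcomb_range_subspace b) w0 cP.
  by rewrite opprD addrCA addNKr.
pose b1 k := if k is l.+1 then b l else w 0%N.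
have b1E p a : lcomb b1 (p * 'X + a%:P) = lcomb b p + a *: w 0%N.
  by rewrite linearD /= lcombMX lcombC.
have b1I : injective (lcomb b1).
  apply: lcomb_inj => p; elim/poly_ind: p => // p a _; rewrite b1E => e.
  have a0 : a = 0.
    have [//|a0] := eqVneq a 0; case: w0.
    exists (- a^-1 *: p) => //; rewrite linearZ /= scaleNr -[RHS]scale1r.
    rewrite -(mulVf a0) -scalerA -scalerN; congr (_ *: _).
    by apply/eqP; rewrite eq_sym -subr_eq0 opprK addrC e.
  by move: e; rewrite a0 scale0r addr0 => /(lcomb_inj0 bI) ->; rewrite mul0r addr0.
have [x|m [b' [b'B b'E]]] := IH (w \o succn) b1 b1I.
  have [c [p _ e]] := wP x; exists (c \o succn), (p * 'X + (c 0%N)%:P) => //.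
  rewrite b1E e big_ord_recl opprD addrA addrAC subrK //.
by exists m.+1, b'; split=> // k; rewrite addSnnS b'E.
Qed.

(** A functional [f n] that is nonzero on the current kernel costs one more spanning vector: a
    multiple of some [y] in that kernel with [f n y != 0] corrects the remainder. *)
Lemma kernel_finite_codim n (f : nat -> {linear V -> K^o}) :
  finite_codim [set x | forall i, (i < n)%N -> f i x = 0].
Proof.
elim: n => [|n [m [v vE]]].
  exists 0%N, (fun=> 0) => x; exists 0 => //.
  by exists (fun=> 0); rewrite big_ord0.
set E := [set x | _] in vE.
have [[y [Ey fy]]|no] := pselect (exists y, E y /\ f n y != 0); last first.
  exists m, v => x; have [z vz Ez] := vE x; exists z => // i.
  rewrite ltnS leq_eqVlt => /orP[/eqP ->|]; last exact: Ez.
  by apply/eqP/negPn/negP => fz; apply: no; exists (x - z).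
have [b vb] := ord_fun_nat v; pose b1 k := if k is l.+1 then b l else y.
exists m.+1, (fun i : 'I_m.+1 => b1 i) => x; have [z + Ez] := vE x.
rewrite vb => /linear_spanP[c zE]; pose a := f n (x - z) / f n y.
exists (a *: y + z).
  apply/linear_spanP; exists (fun k => if k is l.+1 then c l else a).
  by rewrite big_ord_recl zE.
move=> i; rewrite opprD addrCA addrC linearB linearZ /= ltnS leq_eqVlt.
case/orP => [/eqP ->|im]; first by rewrite /a -[_ *: _]/(_ * _) divfK ?subrr.
by rewrite (Ez _ im) (Ey _ im) scaler0 subr0.
Qed.

Lemma image_finite_dim (U : lmodType K) (f : {linear V -> U}) (M : set V) :
  finite_dim M -> finite_dim (f @` M).
Proof.
move=> [n [v ->]]; exists n, (f \o v); apply/seteqP; split.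
  move=> _ [_ [c ->] <-]; exists c; rewrite linear_sum.
  by apply: eq_bigr => i _; rewrite linearZ.
move=> _ [c ->]; exists (\sum_(i < n) c i *: v i); first by exists c.
by rewrite linear_sum; apply: eq_bigr => i _; rewrite linearZ.
Qed.

End FiniteDimension.

(** * The action of polynomials in an endomorphism *)

Section PolynomialAction.
Variables (K : fieldType) (V : lmodType K) (A : {linear V -> V}).
Implicit Types (D E : set V) (p q : {poly K}) (u v w x : V).

(** This is [p(A) v], so [act p v = 0] with [p != 0] is a linear relation among the iterates of
    [v]. *)
Definition act p v := lcomb (fun n => iter n A v) p.

Fact act_is_linear p : linear (act p).
Proof.
move=> a u v; rewrite /act /lcomb scaler_sumr -big_split.
apply: eq_bigr => i _ /=; rewrite scalerA mulrC -scalerA -scalerDr; congr (_ *: _).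
by elim: (nat_of_ord i) => //= n ->; rewrite linearP.
Qed.

HB.instance Definition _ p :=
  GRing.isLinear.Build K V V _ (act p) (act_is_linear p).

Lemma actC a v : act a%:P v = a *: v.
Proof. exact: lcombC. Qed.

Lemma actD p q v : act (p + q) v = act p v + act q v.
Proof. by rewrite /act linearD. Qed.

Lemma actZ a p v : act (a *: p) v = a *: act p v.
Proof. by rewrite /act linearZ. Qed.

Lemma actMX p v : act (p * 'X) v = act p (A v).
Proof.
by rewrite /act lcombMX; congr lcomb; apply/funext => n; rewrite /= -iterS iterSr.
Qed.

Lemma act_comm p v : A (act p v) = act p (A v).
Proof.
rewrite /act lcomb_linear; congr lcomb; apply/funext => n.
by rewrite /= -iterS iterSr.
Qed.

Lemma actM p q v : act (p * q) v = act p (act q v).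
Proof.
elim/poly_ind: p v => [|p a IH] v; first by rewrite mul0r /act !linear0.
rewrite mulrDl mulrAC !actD !actMX IH -act_comm.
by rewrite mul_polyC actZ actC.
Qed.

Lemma act_XsubC a v : act ('X - a%:P) v = A v - a *: v.
Proof.
by rewrite actD -polyCN actC scaleNr -[X in act X]mul1r actMX -polyC1 actC scale1r.
Qed.

Lemma act_eigen p a v : A v = a *: v -> act p v = p.[a] *: v.
Proof.
move=> Av; elim/poly_ind: p => [|p c IH]; first by rewrite /act linear0 horner0 scale0r.
by rewrite actD actMX actC Av linearZ /= IH !hornerE scalerA scalerDl mulrC.
Qed.

End PolynomialAction.

(** * Endomorphisms without invariant half-spaces *)

Section Structure.
Variables (K : closedFieldType) (V : lmodType K) (A : {linear V -> V}).
Implicit Types (D E : set V) (p q : {poly K}) (u v w x : V).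
Local Notation act := (act A).

(** Induction on the linear factors, one root being split off at a time. With the factor on the
    right, [A - a] acts before [p(A)]. *)
Lemma split_poly_ind (P : {poly K} -> Prop) :
  (forall c, c != 0 -> P c%:P) ->
  (forall p a, p != 0 -> P p -> P (p * ('X - a%:P))) ->
  forall p, p != 0 -> P p.
Proof.
move=> P1 PM p; have [n] := ubnP (size p); elim: n p => // n IH p pn p0.
have [s1|/closed_rootP[a /factor_theorem[q pE]]] := eqVneq (size p) 1%N.
  have /size_poly1P[c c0 ->] : size p == 1%N by rewrite s1.
  exact: P1.
have q0 : q != 0 by apply: contraNneq p0 => q0; rewrite pE q0 mul0r.
rewrite pE; apply: PM => //; apply: IH => //.
by move: pn; rewrite pE size_Mmonic ?monicXsubC // size_XsubC addn2.
Qed.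

(** The linear factors of [p] are applied to [v] one after the other; the last nonzero vector before
    the first zero is an eigenvector. *)
Lemma torsion_eigenvector D v p : linear_subspace D -> (forall x, D x -> D (A x)) ->
  D v -> v != 0 -> p != 0 -> act p v = 0 ->
  exists a w, [/\ w != 0, D w & A w = a *: w].
Proof.
move=> sD AD Dv v0 p0; move: p p0 v Dv v0;
  apply: split_poly_ind => [c c0|p a p0 IH] v Dv v0.
  by rewrite actC => /eqP; rewrite scaler_eq0 (negPf c0) (negPf v0).
rewrite actM act_XsubC; have [/eqP|Av0] := eqVneq (A v - a *: v) 0.
  by rewrite subr_eq0 => /eqP Av _; exists a, v.
by apply: IH => //; apply: subspaceB; [|exact: AD|exact: subspaceZ].
Qed.

(** Each factor ['X - a] of [p] costs at most one power of [q]: if [q^k] kills [(A - a) v], then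
    [A - a] kills [q^k(A) v], which is therefore zero or an eigenvector, and [q] kills
    eigenvectors. *)
Lemma torsion_nilpotent q v p :
  (forall a w, w != 0 -> A w = a *: w -> root q a) -> p != 0 -> act p v = 0 ->
  exists k, act (q ^+ k) v = 0.
Proof.
move=> qE p0; move: p p0 v; apply: split_poly_ind => [c c0|p a p0 IH] v.
  rewrite actC => /eqP; rewrite scaler_eq0 (negPf c0) => /eqP ->.
  by exists 0%N; rewrite linear0.
rewrite actM => /IH[k]; rewrite -actM mulrC actM act_XsubC.
move/eqP; rewrite subr_eq0 => /eqP Au.
have [u0|u0] := eqVneq (act (q ^+ k) v) 0; first by exists k.
exists k.+1; rewrite exprS actM (act_eigen _ Au).
by have /rootP -> := qE _ _ u0 Au; rewrite scale0r.
Qed.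

Lemma kernel_act_finite_dim p :
  (forall a, finite_dim [set w | A w = a *: w]) -> p != 0 ->
  finite_dim [set x | act p x = 0].
Proof.
move=> fE p0; move: p p0; apply: split_poly_ind => [c c0|p a p0 IH].
  have -> : [set x | act c%:P x = 0] = linear_span (fun i : 'I_0 => 0).
    apply/seteqP; split=> [x /=|x [d ->]] /=; last by rewrite big_ord0 linear0.
    rewrite actC => /eqP; rewrite scaler_eq0 (negPf c0) => /eqP ->.
    by exists (fun=> 0); rewrite big_ord0.
  by exists 0%N, (fun=> 0).
have -> : [set x | act (p * ('X - a%:P)) x = 0] =
    act ('X - a%:P) @^-1` [set x | act p x = 0].
  by apply/funext => x /=; rewrite actM.
apply: preimage_finite_dim => //.
  exact: (@preimage_subspace _ _ _ (act p) [set 0] (set0_subspace _)).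
suff -> : [set x | act ('X - a%:P) x = 0] = [set w | A w = a *: w] by [].
apply/funext => x /=; rewrite act_XsubC; apply/propext; split.
  by move/eqP; rewrite subr_eq0 => /eqP.
by move=> ->; rewrite subrr.
Qed.

(* The half-space is the span of every other vector of [b]. *)
Lemma eigenvectors_half_space (b : nat -> V) :
  injective (lcomb b) -> (forall n, exists a, A (b n) = a *: b n) ->
  exists E, half_space E /\ forall x, E x -> E (A x).
Proof.
move=> bI /choice[mu bE];
pose b0 n := b n.*2; pose b1 n := b n.*2.+1.
have comp2 p : lcomb b0 p = lcomb b (p \Po 'X^2).
  rewrite comp_polyE linear_sum /=; apply: eq_bigr => i _.
  by rewrite linearZ /= -exprM lcombXn mul2n.
have comp21 p : lcomb b1 p = lcomb b ('X * (p \Po 'X^2)).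
  rewrite comp_polyE mulr_sumr linear_sum /=; apply: eq_bigr => i _.
  by rewrite -scalerAr linearZ /= -exprM -exprS lcombXn mul2n.
have b0I : injective (lcomb b0).
  apply: lcomb_inj => p; rewrite comp2 => /(lcomb_inj0 bI) /polyP p0.
  apply/polyP => i; have := p0 (2 * i)%N.
  by rewrite coef_comp_poly_Xn // dvdn_mulr // mulKn // !coef0.
exists (range (lcomb b0)); split; last first.
  move=> _ [p _ <-]; rewrite lcomb_linear; apply: subspace_lcomb.
    exact: lcomb_range_subspace.
  move=> i; rewrite /= bE; exists (mu i.*2 *: 'X^i) => //.
  by rewrite linearZ /= lcombXn.
split; first exact: lcomb_range_subspace.
  by apply: (independent_infinite b0I) => i; exists 'X^i; rewrite ?lcombXn.
(* With finite codimension, a nonzero combination of the odd vectors [b1] would lie in the span of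
   the even ones; the odd coefficients contradict this. *)
move=> [n [v vP]].
have [p p0 [q _]] := dependent_mod (lcomb_range_subspace b0) (fun i => vP (b1 i)).
rewrite comp2 comp21 => /bI/polyP e; move/eqP: p0; apply; apply/polyP => i.
have := e (2 * i).+1; rewrite coefXM /= !coef_comp_poly_Xn // dvdn_mulr // mulKn //.
by rewrite coef0 => <-; rewrite dvdn2 /= oddM.
Qed.

Hypothesis dichotomy : forall E, linear_subspace E -> (forall x, E x -> E (A x)) ->
  finite_dim E \/ finite_codim E.

(** An infinite independent family of eigenvectors would contradict [dichotomy]. So finitely many
    eigenvectors span all of them; the product [q] over their eigenvalues kills this span, and
    [q(A) w = q(a) w] makes every eigenvalue a root. *)
Lemma eigenvectors_finite : exists q, q != 0 /\
  (forall a w, w != 0 -> A w = a *: w -> root q a) /\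
  (forall a, finite_dim [set w | A w = a *: w]).
Proof.
have [[b [bI bE]]|[n [v [/choice[mu vE] Gv]]]] :=
    independent_or_spanned [set w | exists a, A w = a *: w].
  have [E [[sE Ef Ec] AE]] := eigenvectors_half_space bI bE.
  by case: (dichotomy sE AE).
exists (\prod_(i < n) ('X - (mu i)%:P)); split.
  by apply/monic_neq0/monic_prod_XsubC.
split=> [a w w0 Aw|a]; last first.
  apply: (@finite_dim_sub _ _ _ (linear_span v)); last by exists n, v.
    apply/linear_subspaceP; split=> /= [|c x y Ax Ay].
      by rewrite linear0 scaler0.
    by rewrite linearP Ax Ay scalerDr !scalerA mulrC.
  by move=> w Aw; apply: Gv; exists a.
set q := \prod_(i < n) _.
have : act q w = 0.
  have [c ->] := Gv w (ex_intro _ a Aw).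
  rewrite linear_sum big1 // => i _; rewrite linearZ /= (act_eigen _ (vE i)).
  by rewrite /q horner_prod (bigD1 i) //= !hornerE subrr mul0r scale0r scaler0.
rewrite (act_eigen _ Aw) => /eqP; rewrite scaler_eq0 (negPf w0) orbF.
by [].
Qed.

(* Let [q] vanish at all eigenvalues, so that [N = q(A)] is locally nilpotent with
   finite-dimensional kernel. The spaces [range (N ^ k)] are constant from some [k0]
   on, because their intersections with [ker N] are; on this common range [A - a] is
   surjective for each eigenvalue [a]. *)
Lemma torsion_chain : ~ finite_dim [set: V] ->
  (forall v, exists2 p : {poly K}, p != 0 & act p v = 0) ->
  exists a (u : nat -> V), [/\ injective (lcomb u), A (u 0%N) = a *: u 0%N
    & forall n, A (u n.+1) = a *: u n.+1 + u n].
Proof.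
move=> Vinf tors; have [q [q0 [qE fE]]] := eigenvectors_finite.
pose D k := range (act (q ^+ k)); pose E := [set x | act q x = 0].
have sD k : linear_subspace (D k).
  by apply: image_subspace; apply/linear_subspaceP.
have sE : linear_subspace E.
  exact: (@preimage_subspace _ _ _ (act q) [set 0] (set0_subspace _)).
have actD p k x : D k x -> D k (act p x).
  by move=> [z _ <-]; exists (act p z); rewrite // -!actM mulrC.
have dD k l : (k <= l)%N -> D l `<=` D k.
  move=> kl _ [z _ <-]; exists (act (q ^+ (l - k)) z) => //.
  by rewrite -actM -exprD subnKC.
have [k0 k0P] : exists k0, forall k, (k0 <= k)%N -> D k0 `&` E `<=` D k `&` E.
  apply: (@finite_dim_chain _ _ (fun k => D k `&` E) E).
  - by move=> k; apply: subspaceI.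
  - by move=> k l kl x [/(dD _ _ kl)].
  - exact: kernel_act_finite_dim.
  - by move=> x [].
(* Induction on [j]: if [q^(j+1)] kills [x], then [q^j(A) x] lies in [D k0] and in [E], so it equals
   [q^(k+j)(A) z] for some [z], and [q^j] kills [x - q^k(A) z]. *)
have Dconst j x k : (k0 <= k)%N -> D k0 x -> act (q ^+ j) x = 0 -> D k x.
  move=> kk0; elim: j x => [|j IH] x Dx.
    by rewrite expr0 -polyC1 actC scale1r => ->; apply: subspace0.
  rewrite exprS actM => Ex.
  have [||[z _ zE] _] := k0P (k + j)%N _ (act (q ^+ j) x).
  - exact: leq_trans kk0 (leq_addr _ _).
  - by split=> //; apply: actD.
  have Dz : D k (act (q ^+ k) z) by exists z.
  rewrite -[x](subrK (act (q ^+ k) z)); apply: subspaceD => //.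
  apply: IH; first by apply: subspaceB => //; apply: dD Dz.
  by rewrite linearB /= -zE -actM -exprD addnC subrr.
have Dsurj x : D k0 x -> exists2 y, D k0 y & act q y = x.
  move=> Dx; have [p p0 px] := tors x.
  have [j jx] := torsion_nilpotent qE p0 px.
  have [z _ <-] := Dconst j x k0.+1 (leqnSn _) Dx jx.
  by exists (act (q ^+ k0) z); [exists z|rewrite -actM -exprS].
have [v [Dv v0]] : exists v, D k0 v /\ v != 0.
  apply: contrapT => no; apply: Vinf.
  suff <- : [set x | act (q ^+ k0) x = 0] = [set: V].
    by apply: kernel_act_finite_dim; rewrite ?expf_neq0.
  apply/seteqP; split=> // x _ /=; apply/eqP/negPn/negP => x0.
  by apply: no; exists (act (q ^+ k0) x); split=> //; exists x.
have [p p0 pv] := tors v.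
have AD x : D k0 x -> D k0 (A x).
  by move=> /(actD 'X); rewrite -[X in act X]mul1r actMX -polyC1 actC scale1r.
have [a [u0 [u0n Du0 Au0]]] := torsion_eigenvector (sD k0) AD Dv v0 p0 pv.
have /factor_theorem[q1 q1E] := qE _ _ u0n Au0.
(* Since [q = q1 * ('X - a)], a preimage [y] of [x] under [q(A)] gives the preimage [q1(A) y] under
   [A - a]. *)
have /choice[s sP] : forall x, exists y, D k0 x -> D k0 y /\ A y = a *: y + x.
  move=> x; have [Dx|] := pselect (D k0 x); last by exists 0.
  have [y Dy yx] := Dsurj x Dx; exists (act q1 y) => _; split; first exact: actD.
  by rewrite -yx q1E mulrC actM act_XsubC addrC subrK.
pose u n := iter n s u0.
have Du n : D k0 (u n) by elim: n => //= n Dn; have [] := sP _ Dn.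
have uS n : A (u n.+1) = a *: u n.+1 + u n by have [] := sP _ (Du n).
exists a, u; split=> //; apply: lcomb_inj => r; elim/poly_ind: r => // r c IH.
rewrite linearD /= lcombMX lcombC => e.
(* Applying [A - a] to the relation kills the [u0] term and lowers every other index by one, which
   leaves the relation [r]. *)
have r0 : r = 0.
  apply: IH; have := congr1 (act ('X - a%:P)) e.
  rewrite linear0 linearD linearZ /= act_XsubC [in X in _ + X]act_XsubC.
  rewrite Au0 subrr scaler0 addr0 -act_XsubC lcomb_linear => {1}<-.
  by congr lcomb; apply/funext => n; rewrite /= act_XsubC uS addrC addKr.
move: e; rewrite r0 linear0 add0r => /eqP; rewrite scaler_eq0 (negPf u0n) orbF.
by move=> /eqP ->; rewrite mul0r addr0.
Qed.

(** In either case the chain spans an infinite-dimensional invariant subspace, which [dichotomy]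
    makes of finite codimension. Completing it to a basis puts [m] vectors in front, hence the bound
    [m <= n] in both recurrences. *)
Lemma shift_basis : ~ finite_dim [set: V] ->
  exists (b : nat -> V) m, bijective (lcomb b) /\
  ((forall n, (m <= n)%N -> A (b n) = b n.+1) \/
   (exists a, forall n, (m <= n)%N -> A (b n.+1) = a *: b n.+1 + b n)).
Proof.
move=> Vinf.
have complete b : injective (lcomb b) ->
    (forall n, range (lcomb b) (A (b n))) ->
    exists m b', bijective (lcomb b') /\ forall k, b' (m + k)%N = b k.
  move=> bI Ab; have sb := lcomb_range_subspace b.
  have [x [p _ <-]||[n [v vP]]] := dichotomy sb.
  - by rewrite lcomb_linear; apply: subspace_lcomb.
  - move=> fb; case: (independent_infinite bI _ fb) => i.
    by exists 'X^i; rewrite ?lcombXn.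
  have [w vE] := ord_fun_nat v; apply: (@basis_completion _ _ n w) => // x.
  have [y + bxy] := vP x; rewrite vE => /linear_spanP[c yE].
  by exists c; rewrite -yE.
have [tors|] := pselect (forall v, exists2 p : {poly K}, p != 0 & act p v = 0).
  have [a [u [uI u0 uS]]] := torsion_chain Vinf tors.
  have [|m [b [bB bE]]] := complete u uI.
    move=> [|n]; [rewrite u0|rewrite uS].
      by exists (a *: 'X^0 : {poly K}); rewrite // linearZ /= lcombXn.
    by exists (a *: 'X^(n.+1) + 'X^n : {poly K}); rewrite // linearP /= !lcombXn.
  exists b, m; split=> //; right; exists a => n /subnKC <-.
  by rewrite -addnS !bE uS.
move=> /existsNP[v nv]; pose u n := iter n A v.
have uI : injective (lcomb u).
  apply: lcomb_inj => p pv; apply/eqP/negPn/negP => p0; apply: nv.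
  by exists p.
have [|m [b [bB bE]]] := complete u uI.
  by move=> n; exists 'X^(n.+1); rewrite // lcombXn.
exists b, m; split=> //; left=> n /subnKC <-.
by rewrite -addnS !bE.
Qed.

End Structure.

(** * Duality between sequences and polynomials *)

Section Duality.
Variable R : realType.
Local Notation K := (Cfield R).
Implicit Types (x y z : omega R) (p q : {poly K}) (s t : nat -> {poly K}).

(* The polynomials are the continuous dual of [omega R]: the coefficients of [p]
   are the coordinates of the functional [pairing^~ p]. *)
Definition pairing x p : K^o := @lcomb K K^o x p.

Lemma pair_widen n x p : (size p <= n)%N -> pairing x p = \sum_(i < n) p`_i * x i.
Proof. exact: lcomb_widen. Qed.

Lemma pairXn x n : pairing x 'X^n = x n.
Proof. exact: lcombXn. Qed.

Fact pair_is_linear x : linear (pairing x).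
Proof. exact: lcomb_is_linear. Qed.

HB.instance Definition _ x :=
  GRing.isLinear.Build K {poly K} K^o _ (pairing x) (pair_is_linear x).

(** The pairing with its arguments exchanged, so that linearity in the sequence can be registered as
    well. *)
Definition functional p : omega R -> K^o := fun x => pairing x p.

Fact functional_is_linear p : linear (functional p).
Proof.
move=> a x y; rewrite /functional /pairing /lcomb scaler_sumr -big_split.
apply: eq_bigr => i _ /=; rewrite -[(a *: x + y) i]/(a * x i + y i).
by rewrite scalerDr; congr (_ + _); rewrite -![_ *: _]/(_ * _) mulrCA.
Qed.

HB.instance Definition _ p :=
  GRing.isLinear.Build K (omega R) K^o _ (functional p) (functional_is_linear p).

Lemma coordinate_continuous n : continuous (fun x : omega R => x n : K).
Proof. by move=> x; exact: (@proj_continuous _ (fun=> K) n x). Qed.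

Lemma functional_continuous p : continuous (functional p : omega R -> K).
Proof.
suff H n : continuous (fun x : omega R => \sum_(i < n) p`_i * x i : K).
  exact: (H (size p)).
elim: n => [|n IH].
  rewrite (_ : (fun _ => _) = fun=> 0); last by apply/funext => x; rewrite big_ord0.
  by move=> x; apply: (@cvg_cst K 0 (omega R) (nbhs x)).
rewrite (_ : (fun _ => _) = fun x : omega R =>
  \sum_(i < n) p`_i * x i + p`_n * x n); last first.
  by apply/funext => x; rewrite big_ord_recr.
move=> x; apply: (@cvgD K K (omega R) (nbhs x)); first exact: IH.
by apply: (@cvgMl_tmp K (omega R) (nbhs x)); exact: coordinate_continuous.
Qed.

(* [transp t] is the adjoint of the linear map [lcomb t] on polynomials. *)
Definition transp t x : omega R := fun n => pairing x (t n).

Fact transp_is_linear t : linear (transp t).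
Proof.
move=> a x y; apply/funext => n.
by rewrite /transp -!/(functional _ _) linearP.
Qed.

HB.instance Definition _ t :=
  GRing.isLinear.Build K (omega R) (omega R) _ (transp t) (transp_is_linear t).

Lemma transp_operator t : operator (transp t).
Proof.
split; first exact: transp_is_linear.
by move=> x; apply/pointwise_cvgP => n; apply: functional_continuous.
Qed.

Lemma pair_transp t x p : pairing (transp t x) p = pairing x (lcomb t p).
Proof. by rewrite lcomb_linear. Qed.

Lemma lcombXnE p : lcomb (fun n => 'X^n : {poly K}) p = p.
Proof. by rewrite /lcomb -poly_def coefK. Qed.

Definition unit_seq i : omega R := fun n => (n == i)%:R.

Lemma omega_sumE n (F : 'I_n -> omega R) k :
  (\sum_(i < n) F i) k = \sum_(i < n) F i k :> K.
Proof.
by apply: (big_morph (fun x : omega R => x k : K)).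
Qed.

Lemma unit_sumE n (c : nat -> K) k :
  (\sum_(i < n) c i *: unit_seq i) k = (if (k < n)%N then c k else 0) :> K.
Proof.
rewrite omega_sumE; have E i : (c i *: unit_seq i) k = c i * (k == i)%:R :> K by [].
under eq_bigr do rewrite E.
case: ltnP => [kn|nk].
  rewrite (bigD1 (Ordinal kn)) //= eqxx mulr1 big1 ?addr0 // => i.
  by rewrite -val_eqE /= eq_sym => /negPf ->; rewrite mulr0.
rewrite big1 // => i _; rewrite gtn_eqF ?mulr0 //.
exact: leq_trans (ltn_ord i) nk.
Qed.

Lemma pair_unit i p : pairing (unit_seq i) p = p`_i.
Proof.
rewrite (@pair_widen (maxn (size p) i.+1)) ?leq_maxl //.
rewrite (bigD1 (Ordinal (leq_maxr (size p) i.+1))) //= /unit_seq eqxx mulr1.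
rewrite big1 ?addr0 // => j; rewrite -val_eqE /= => /negPf ->.
by rewrite mulr0.
Qed.

(** By continuity at 0, a bound on some seminorm forces [|T y n| < 1]. A [y] with zero coordinates
    up to [j] meets this bound after any rescaling, so [T y n = 0]. Hence [T x n] depends on
    finitely many coordinates of [x], with coefficients [T (unit_seq i) n]. *)
Lemma operator_transp (T : omega R -> omega R) : operator T -> exists t, T = transp t.
Proof.
move=> [Tlin Tcont].
pose TL : {linear omega R -> omega R} := HB.pack T
  (GRing.isLinear.Build K (omega R) (omega R) _ T Tlin).
have TZ a x : T (a *: x) = a *: T x by exact: (linearZ_LR TL).
have /choice[j jP] : forall n, exists j, forall y : omega R,
    (forall i, (i <= j)%N -> y i = 0) -> T y n = 0.
  move=> n.
  have cT : continuous (fun x => T x n : K).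
    move=> x; apply: (@cvg_comp _ _ _ T (fun y : omega R => y n : K) _ (nbhs (T x))).
      exact: Tcont.
    exact: coordinate_continuous.
  have T0 : T 0 n = 0 by rewrite [T 0](linear0 TL).
  have : T x n @[x --> (0 : omega R)] --> (0 : K) by rewrite -T0; exact: cT.
  move=> /cvgr_dist_lt /(_ 1 ltr01) /nbhs_omegaP[j [e [e0 eT]]]; exists j => y y0.
  apply/eqP/negPn/negP => Ty.
  have := eT ((T y n)^-1 *: y); rewrite /= subr0 => /(_ _) H.
  have : `|0 - T ((T y n)^-1 *: y) n| < 1.
    apply: H; apply/omega_seminorm_lt => // i ij.
    rewrite -[((T y n)^-1 *: y) i]/((T y n)^-1 * y i) y0 // mulr0 normr0 //.
  rewrite TZ -[(_ *: _) n]/((T y n)^-1 * T y n) mulVf //.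
  by rewrite sub0r normrN normr1 ltxx.
exists (fun n => \poly_(i < (j n).+1) (T (unit_seq i) n)).
apply/funext => x; apply/funext => n; rewrite /transp.
rewrite (@pair_widen (j n).+1) ?size_poly //.
pose y : omega R := \sum_(i < (j n).+1) x i *: unit_seq i.
have : T (x - y) n = 0.
  apply: jP => i ij; rewrite -[(x - y) i]/(x i - y i) /y unit_sumE ltnS ij.
  by rewrite subrr.
rewrite [T _](linearB TL) -[(_ - _) n]/(T x n - T y n) => /eqP.
rewrite subr_eq0 => /eqP ->; rewrite [T y](linear_sum TL) omega_sumE.
apply: eq_bigr => i _; rewrite coef_poly ltn_ord -[LHS]/(T (_ *: _) n) TZ.
by rewrite -[(_ *: _) n]/(x i * T (unit_seq i) n) mulrC.
Qed.

Lemma closed_approx (M : set (omega R)) y : closed M ->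
  (forall n, exists2 z, M z & forall i, (i < n)%N -> z i = y i) -> M y.
Proof.
move=> cM H; apply: cM => B /nbhs_omegaP[j [e [e0 eB]]].
have [z Mz zy] := H j.+1; exists z; split=> //; apply: eB => /=.
apply/omega_seminorm_lt => // n nj.
by rewrite -[(z - y) n]/(z n - y n) zy // subrr normr0.
Qed.

Definition annihilator (N : set {poly K}) : set (omega R) :=
  [set x | forall p, N p -> pairing x p = 0].

Lemma annihilator_subspace N : linear_subspace (annihilator N).
Proof.
apply/linear_subspaceP; split=> [|a x y Nx Ny] p Np.
  by rewrite -[LHS]/(functional p 0) linear0.
by rewrite -[LHS]/(functional p _) linearP /= /functional Nx // Ny // scaler0 addr0.
Qed.

Lemma annihilator_closed N : closed (annihilator N).
Proof.
have -> : annihilator N = \bigcap_(p in N) ((functional p : omega R -> K) @^-1` [set 0]).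
  by apply/seteqP; split=> x Nx p /Nx.
apply: closed_bigI => p _; move/continuous_closedP: (@functional_continuous p).
apply; apply: accessible_closed_set1; apply: hausdorff_accessible.
exact: norm_hausdorff.
Qed.

(* The coordinates of [x] are chosen recursively: zero below the degree [e] of [p]
   (reduced modulo [N] so that [e] is not the degree of an element of [N]), one at
   [e], and at any degree realised in [N], so as to kill one such element. *)
Lemma bipolar (N : set {poly K}) p : linear_subspace N -> ~ N p ->
  exists2 x, annihilator N x & pairing x p != 0.
Proof.
move=> sN; have [n] := ubnP (size p); elim: n p => // n IH p pn Np.
have p0 : p != 0 by apply: contra_not_neq Np => ->; exact: subspace0.
have reduce (q r : {poly K}) : q != 0 -> size q = size r ->
    (size (q - (lead_coef q / lead_coef r) *: r)%R < size q)%N.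
  move=> q0 qr; have sq : (0 < size q)%N by rewrite size_poly_gt0.
  rewrite -[X in (_ < X)%N](prednK sq) ltnS; apply/leq_sizeP => j.
  rewrite leq_eqVlt coefB coefZ => /orP[/eqP <-|]; last first.
    by rewrite prednK // => jq; rewrite !nth_default -?qr // mulr0 subrr.
  rewrite {2}qr -!lead_coefE divfK ?subrr //.
  by rewrite lead_coef_eq0 -size_poly_gt0 -qr.
have [[q [Nq qp]]|noq] := pselect (exists q, N q /\ size q = size p).
  have [||x Nx xp] := IH (p - (lead_coef p / lead_coef q) *: q).
  - by apply: leq_trans (reduce _ _ _ _) _.
  - move=> Np'; apply: Np.
    have := subspaceD sN Np' (subspaceZ (lead_coef p / lead_coef q) sN Nq).
    by rewrite subrK.
  by exists x => //; move: xp; rewrite linearB linearZ /= (Nx q) // scaler0 subr0.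
(* [r k] is an element of [N] of degree [k] if there is one, and arbitrary otherwise. *)
have /choice[r rP] : forall k, exists q, (exists2 q', N q' & size q' = k.+1) ->
    N q /\ size q = k.+1.
  move=> k; have [[q Nq qk]|] := pselect (exists2 q', N q' & size q' = k.+1).
    by exists q.
  by exists 0.
pose e := (size p).-1; have eE : size p = e.+1 by rewrite prednK ?size_poly_gt0.
pose step (l : seq K) := let k := size l in
  if (k < e)%N then 0 else if k == e then 1
  else - (lead_coef (r k))^-1 * \sum_(i < k) (r k)`_i * l`_i.
pose pre := fix pre k := if k is l.+1 then rcons (pre l) (step (pre l)) else [::].
pose x : omega R := fun k => step (pre k).
have preE k : pre k = mkseq x k by elim: k => //= k kE; rewrite mkseqS -kE.
have xE k : x k = if (k < e)%N then 0 else if k == e then 1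
    else - (lead_coef (r k))^-1 * \sum_(i < k) (r k)`_i * x i.
  rewrite {1}/x preE /step size_mkseq; do 2!case: ifP => // _.
  by congr (_ * _); apply: eq_bigr => i _; rewrite nth_mkseq.
exists x; last first.
  rewrite (@pair_widen e.+1) ?eE // big_ord_recr /= big1 ?add0r.
    by rewrite xE ltnn eqxx mulr1 -lead_coefE lead_coef_eq0.
  by move=> i _; rewrite xE ltn_ord mulr0.
(* An arbitrary [q] in [N] is reduced to smaller size by the [r d] of its own degree, which [x]
   kills. *)
move=> q; have [k] := ubnP (size q); elim: k q => // k IHk q qk Nq.
have [->|q0] := eqVneq q 0; first by rewrite linear0.
have sq : size q = (size q).-1.+1 by rewrite prednK ?size_poly_gt0.
set d := (size q).-1 in sq; have [Nr rd] := rP d (ex_intro2 _ _ q Nq sq).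
have xr : pairing x (r d) = 0.
  have [de|ed|/esym ed] := ltngtP d e.
  - rewrite (@pair_widen d.+1) ?rd // big1 // => i _.
    by rewrite xE (leq_trans (ltn_ord i) de) mulr0.
  - rewrite (@pair_widen d.+1) ?rd // big_ord_recr /= [x d]xE.
    rewrite ltnNge (ltnW ed) /= gtn_eqF // [X in X * (_ * _)](_ : _ = lead_coef (r d)).
      rewrite mulrA mulrN divff ?mulN1r ?subrr //.
      by rewrite lead_coef_eq0 -size_poly_gt0 rd.
    by rewrite lead_coefE rd.
  - by case: noq; exists q; rewrite sq eE ed.
have Nq' : N (q - (lead_coef q / lead_coef (r d)) *: r d).
  by apply: subspaceB => //; apply: subspaceZ.
have <- : pairing x (q - (lead_coef q / lead_coef (r d)) *: r d) = pairing x q.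
  by rewrite linearB linearZ /= xr scaler0 subr0.
apply: (IHk _ _ Nq').
by apply: leq_trans (reduce _ _ _ _) _; rewrite ?rd.
Qed.

Lemma poly_infinite_dim : ~ finite_dim [set: {poly K}].
Proof.
apply: (@independent_infinite _ _ (fun n => 'X^n)) => //.
by move=> p q; rewrite !lcombXnE.
Qed.

(** The annihilator of an invariant half-space [N] would be a closed invariant half-space. If [n]
    sequences spanned it, [bipolar] would put into [N] all polynomials they kill, a space of finite
    codimension. If [n] sequences spanned a complement, a nonzero [p] in [N] killed by them would
    pair to zero with every [unit_seq i]. *)
Lemma dual_dichotomy t :
  ~ (exists M, [/\ closed M, half_space M & invariant_for (transp t) M]) ->
  forall N, linear_subspace N -> (forall p, N p -> N (lcomb t p)) ->
  finite_dim N \/ finite_codim N.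
Proof.
move=> noM N sN tN; apply: contrapT => /not_orP[Nf Nc]; apply: noM.
exists (annihilator N); split; first exact: annihilator_closed; last first.
  by move=> _ [x Nx <-] p Np; rewrite pair_transp; apply/Nx/tN.
split; first exact: annihilator_subspace.
  move=> [n [v Mv]]; apply: Nc; have [b vb] := ord_fun_nat v.
  apply: finite_codim_sub (kernel_finite_codim n (fun i => pairing (b i))).
  move=> p bp; apply: contrapT => /(bipolar sN)[x]; rewrite Mv => -[c ->].
  rewrite -[pairing _ _]/(functional p _) linear_sum big1 ?eqxx // => i _.
  by rewrite linearZ /= /functional vb bp // scaler0.
move=> [n [v vM]]; have [b vb] := ord_fun_nat v.
have sE : linear_subspace [set p | forall i, (i < n)%N -> pairing (b i) p = 0].
  apply/linear_subspaceP; split=> [i _|a p q Ep Eq i ni]; first by rewrite linear0.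
  by rewrite linearP /= Ep // Eq // scaler0 addr0.
have [p [p0 Np bp]] := infinite_meets_cofinite sN sE Nf
  (kernel_finite_codim n (fun i => pairing (b i))).
move/eqP: p0; apply; apply/polyP => i; rewrite -pair_unit coef0.
have [y [c yE] /(_ p Np)] := vM (unit_seq i).
rewrite -![pairing _ p]/(functional p _) linearB /= => /eqP; rewrite subr_eq0 => /eqP ->.
rewrite yE linear_sum big1 // => j _.
by rewrite linearZ /= /functional vb bp // scaler0.
Qed.

Lemma finite_rank_transp t m : (forall n, (m <= n)%N -> t n = 0) ->
  finite_rank (transp t).
Proof.
move=> t0; apply: (@finite_dim_sub _ _ _ (linear_span (fun i : 'I_m => unit_seq i))).
- by apply: image_subspace; apply/linear_subspaceP.
- move=> _ [x _ <-]; apply/linear_spanP; exists (transp t x); apply/funext => n.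
  rewrite unit_sumE; case: ltnP => // /t0 tn.
  by rewrite /transp tn linear0.
- by exists m, (fun i : 'I_m => unit_seq i).
Qed.

(** [transp b] is the change of basis; its inverse is [transp c], where [c n] holds the coordinates
    of ['X^n] in the basis [b]. The defects [r n] from the model [u] vanish from [m] on, so the
    correction has finite rank. *)
Lemma conjugate_perturbation t (u b : nat -> {poly K}) (a : K) m :
  bijective (lcomb b) ->
  (forall n, (m <= n)%N -> lcomb t (b n) = lcomb b (u n) + a *: b n) ->
  exists S, [/\ operator S, finite_rank S &
    conjugate_to (transp t) (transp u \+ a \*: idfun \+ S)].
Proof.
move=> [g bK gK] tb; pose c n := g 'X^n.
pose r n := lcomb t (b n) - (lcomb b (u n) + a *: b n).
have cE p : lcomb c p = g p.
  apply: (can_inj bK); rewrite gK lcomb_linear -[RHS]lcombXnE.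
  by congr lcomb; apply/funext => n; rewrite /= gK.
exists (transp (fun n => lcomb c (r n))); split.
- exact: transp_operator.
- apply: (@finite_rank_transp _ m) => n mn.
  by rewrite /r tb // subrr linear0.
have bcK : cancel (transp b) (transp c).
  move=> x; apply/funext => n; rewrite /transp -/(transp b x) pair_transp gK.
  exact: pairXn.
have cbK : cancel (transp c) (transp b).
  move=> x; apply/funext => n; rewrite /transp -/(transp c x) pair_transp cE.
  by rewrite -[b n]lcombXn bK pairXn.
exists (transp b), (transp c); split=> //; try exact: transp_operator.
apply/funext => x; rewrite -[LHS]bcK /=; congr (transp c); apply/funext => n.
rewrite -[RHS]/(pairing (transp b x) (u n) + a * transp b x n
  + pairing (transp b x) (lcomb c (r n))).
rewrite -[LHS]/(pairing (transp t x) (b n)) -[transp b x n]/(pairing x (b n)).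
rewrite !pair_transp cE gK -[a * _]linearZ -!linearD /=.
by rewrite /r addrC subrK.
Qed.

Lemma backward_shiftE : @backward_shift R = transp (fun n => 'X^(n.+1)).
Proof. by apply/funext => x; apply/funext => n; rewrite /transp pairXn. Qed.

Lemma forward_shiftE :
  @forward_shift R = transp (fun n => if n is k.+1 then 'X^k else 0).
Proof.
apply/funext => x; apply/funext => -[|n]; rewrite /transp ?pairXn //.
by rewrite linear0.
Qed.

Lemma no_half_space_conjugate (T : omega R -> omega R) : operator T ->
  ~ (exists M, [/\ closed M, half_space M & invariant_for T M]) ->
  exists (lambda : K) (S : omega R -> omega R),
    [/\ operator S, finite_rank S &
      conjugate_to T (@backward_shift R \+ lambda \*: idfun \+ S) \/
      conjugate_to T (@forward_shift R \+ lambda \*: idfun \+ S)].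
Proof.
move=> /operator_transp[t ->] /dual_dichotomy dich.
have [b [m [bB [tb|[a tb]]]]] := shift_basis (A := lcomb t) dich poly_infinite_dim.
  have [|S [oS fS cS]] := @conjugate_perturbation t (fun n => 'X^(n.+1)) b 0 m bB.
    by move=> n /tb ->; rewrite scale0r addr0 lcombXn.
  by exists 0, S; split=> //; left; rewrite backward_shiftE.
(* The recurrence at [n] describes [b n.+1], so the model holds from [m.+1] on. *)
have [|S [oS fS cS]] := @conjugate_perturbation t
    (fun n => if n is k.+1 then 'X^k else 0) b a m.+1 bB.
  by case=> // n /tb ->; rewrite lcombXn addrC.
by exists a, S; split=> //; right; rewrite forward_shiftE.
Qed.

End Duality.

(** * Perturbed shifts *)

Section Shifts.
Variable R : realType.
Local Notation K := (Cfield R).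
Implicit Types (x y z : omega R) (p q : {poly K}) (s t : nat -> {poly K}).
Implicit Types M : set (omega R).

Definition zeros_below n : set (omega R) := [set x | forall i, (i < n)%N -> x i = 0].

Lemma zeros_below_subspace n : linear_subspace (zeros_below n).
Proof.
apply/linear_subspaceP; split=> // a x y x0 y0 i ni.
by rewrite -[LHS]/(a * x i + y i) x0 // y0 // mulr0 addr0.
Qed.

Lemma zeros_below_finite_codim n : finite_codim (zeros_below n).
Proof.
apply: finite_codim_sub (kernel_finite_codim n (fun i => @functional R 'X^i)).
by move=> x xn i ni; rewrite -[LHS]pairXn; apply: xn.
Qed.

(** The elements of the range vanishing below [k] form a decreasing chain, which stabilises at some
    [k0] and must then be zero. The first [k0] coordinates of [transp s x] involve only finitely
    many coordinates of [x], and [d] bounds their indices. *)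
Lemma finite_rank_zeros_below s : finite_rank (transp s) ->
  exists d, forall x, zeros_below d x -> transp s x = 0.
Proof.
move=> fs; have sr : linear_subspace (range (transp s)).
  by apply: image_subspace; apply/linear_subspaceP.
have [||k0 k0P] := finite_dim_chain (D := fun k => range (transp s) `&` zeros_below k)
    _ _ fs (@subIsetl _ _ _).
- by move=> k; apply: subspaceI => //; apply: zeros_below_subspace.
- by move=> k l kl x [sx x0]; split=> // i ik; apply/x0/(leq_trans ik).
exists (\max_(i < k0) size (s i)) => x x0.
have H : (range (transp s) `&` zeros_below k0) (transp s x).
  split; first by exists x.
  move=> i ik; rewrite /transp (pair_widen x (leqnn _)) big1 // => j _.
  rewrite x0 ?mulr0 //; apply: leq_trans (ltn_ord j) _.
  exact: (@leq_bigmax _ (fun i : 'I_k0 => size (s i)) (Ordinal ik)).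
apply/funext => n; have [|_ ] := k0P (maxn k0 n.+1) _ _ H; first exact: leq_maxl.
by apply; apply: leq_maxr.
Qed.

(** The shifts [u k] of [x] have their first nonzero coordinates at [e + k], so triangular
    elimination approximates every sequence vanishing below [e]; closedness puts all of these into
    [M]. *)
Lemma forward_shift_no_half_space s M : finite_rank (transp s) ->
  closed M -> linear_subspace M -> invariant_for (@forward_shift R \+ transp s) M ->
  ~ finite_dim M -> finite_codim M.
Proof.
move=> /finite_rank_zeros_below[d sd] cM sM iM Mi.
have [x [x0 Mx xd]] := infinite_meets_cofinite sM (zeros_below_subspace d) Mi
  (zeros_below_finite_codim d).
have ex : exists n, x n != 0.
  apply: contrapT => no; move/eqP: x0; apply; apply/funext => n.
  by apply/eqP/negPn/negP => xn; apply: no; exists n.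
case: (ex_minnP ex) => e xe emin.
have de : (d <= e)%N by rewrite leqNgt; apply/negP => /xd /eqP; apply/negP.
pose u k := iter k (@forward_shift R) x.
have uE k n : u k n = if (n < k)%N then 0 else x (n - k)%N.
  elim: k n => [|k IH] n; first by rewrite subn0.
  by case: n => [|n] //; rewrite -[LHS]/(u k n) IH ltnS subSS.
have ud k : zeros_below (e + k) (u k).
  move=> i ie; rewrite uE; case: ltnP => // ki; apply/eqP/negPn/negP => /emin.
  by rewrite leqNgt ltn_subLR // addnC ie.
have Mu k : M (u k).
  elim: k => // k IH; apply: iM; exists (u k) => //=.
  rewrite sd ?addr0 // => i id; apply: ud.
  exact: leq_trans id (leq_trans de (leq_addr _ _)).
apply: finite_codim_sub (zeros_below_finite_codim e) => y ye.
apply: closed_approx cM _ => n.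
suff [z Mz zy] : exists2 z, M z & forall i, (i < e + n)%N -> z i = y i.
  by exists z => // i ni; apply/zy/(leq_trans ni)/leq_addl.
elim: n => [|n [z Mz zy]].
  exists 0; first exact: subspace0.
  by move=> i; rewrite addn0 => /ye ->.
(* [u n] vanishes before [e + n] and takes the value [x e] there: adding its multiple corrects this
   coordinate and leaves the earlier ones alone. *)
exists (((y (e + n)%N - z (e + n)%N) / x e) *: u n + z).
  exact: subspaceP.
move=> i; rewrite -[(_ + z) i]/(((y (e + n)%N - z (e + n)%N) / x e) * u n i + z i).
rewrite addnS ltnS leq_eqVlt => /orP[/eqP ->|ie]; last by rewrite ud // mulr0 add0r zy.
by rewrite uE ltnNge leq_addl /= addnK divfK // subrK.
Qed.

Lemma size_lcomb s d p : (forall n, (size (s n) <= d)%N) -> (size (lcomb s p) <= d)%N.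
Proof.
move=> sd; apply/leq_sizeP => j dj; rewrite /lcomb coef_sum big1 // => i _.
by rewrite coefZ [(s i)`_j]nth_default ?mulr0 // (leq_trans (sd i)).
Qed.

(* A point [y] of [zeros_below d] outside [M] is separated from [M] by its first [n]
   coordinates, hence by a functional [f], and [size f <= d] would give [f y = 0]. *)
Lemma large_annihilating_functional d M : closed M -> linear_subspace M ->
  ~ finite_codim M ->
  exists2 f : {poly K}, (d < size f)%N & forall x, M x -> pairing x f = 0.
Proof.
move=> cM sM Mc; apply: contrapT => no; apply: Mc.
apply: finite_codim_sub (zeros_below_finite_codim d) => y yd.
apply: closed_approx cM _ => n; apply: contrapT => ny.
pose trunc (x : omega R) : {poly K} := \poly_(i < n) x i.
have truncE x z : pairing x (trunc z) = \sum_(i < n) z i * x i.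
  rewrite (pair_widen _ (size_poly _ _)); apply: eq_bigr => i _.
  by rewrite coef_poly ltn_ord.
have sN : linear_subspace (trunc @` M).
  apply/linear_subspaceP; split.
    exists 0; first exact: subspace0.
    by apply/polyP => i; rewrite coef_poly coef0; case: ifP.
  move=> a _ _ [x Mx <-] [z Mz <-]; exists (a *: x + z); first exact: subspaceP.
  apply/polyP => i; rewrite coefD coefZ !coef_poly; case: ifP => // _.
  by rewrite mulr0 addr0.
have [|x Nx xy] := bipolar sN (p := trunc y).
  move=> [z Mz /polyP zy]; apply: ny; exists z => // i ni.
  by have := zy i; rewrite !coef_poly ni.
(* The truncated pairing is symmetric, which turns the separating sequence [x] into the polynomial
   [trunc x]. *)
have tx z : pairing z (trunc x) = pairing x (trunc z).
  by rewrite !truncE; apply: eq_bigr => i _; rewrite mulrC.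
move/eqP: xy; apply; rewrite -tx.
have [ds|sd] := ltnP d (size (trunc x)).
  case: no; exists (trunc x) => // z Mz; rewrite tx; apply: Nx.
  by exists z.
by rewrite (pair_widen _ sd) big1 // => i _; rewrite yd ?ltn_ord // mulr0.
Qed.

(** The adjoint [A] of the perturbed shift raises the size of [f] by exactly one at each step,
    because the terms [s n] have size at most [d]. So functionals of every degree from [n] on
    annihilate [M], and an element of [M] vanishing below [n] is zero, one coordinate after the
    other. *)
Lemma backward_shift_no_half_space s M : finite_rank (transp s) ->
  closed M -> linear_subspace M -> invariant_for (@backward_shift R \+ transp s) M ->
  ~ finite_codim M -> finite_dim M.
Proof.
move=> /finite_rank_zeros_below[d sd] cM sM iM Mc.
have ss n : (size (s n) <= d)%N.
  apply/leq_sizeP => j dj; rewrite -pair_unit -[LHS]/(transp s _ n) sd // => i id.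
  by rewrite /unit_seq ltn_eqF // (leq_trans id).
have [f df fM] := large_annihilating_functional d cM sM Mc.
pose A p := p * 'X + lcomb s p.
have pairA x p : pairing x (A p) = pairing (backward_shift x + transp s x) p.
  rewrite linearD -[in RHS]/(functional p _) linearD /= /functional pair_transp.
  by congr (_ + _); rewrite /pairing lcombMX.
have AM k x : M x -> pairing x (iter k A f) = 0.
  elim: k x => [|k IH] x Mx; first exact: fM.
  by rewrite /= pairA; apply/IH/iM; exists x.
have sA k : size (iter k A f) = (size f + k)%N.
  elim: k => [|k IH]; first by rewrite addn0.
  have f0 : iter k A f != 0.
    by rewrite -size_poly_gt0 IH (leq_trans _ (leq_addr _ _)) ?(leq_trans _ df).
  rewrite /= /A size_polyDl size_mulX // IH ?addnS // ltnS.
  apply: leq_trans (size_lcomb _ ss) _.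
  exact: leq_trans (ltnW df) (leq_addr _ _).
apply: contrapT => Mi; pose n := (size f).-1.
have fn : size f = n.+1 by rewrite prednK // (leq_trans _ df).
have [x [x0 Mx xn]] := infinite_meets_cofinite sM (zeros_below_subspace n) Mi
  (zeros_below_finite_codim n).
move/eqP: x0; apply; apply/funext => i; elim/ltn_ind: i => i IH.
have [/xn//|ni] := ltnP i n.
have := AM (i - n)%N x Mx; have := sA (i - n)%N; rewrite fn addSn subnKC // => si.
rewrite (pair_widen _ (eq_leq si)) big_ord_recr /= big1 ?add0r.
  move=> /eqP; rewrite mulf_eq0 => /orP[|/eqP //].
  have -> : (iter (i - n) A f)`_i = lead_coef (iter (i - n) A f) by rewrite lead_coefE si.
  by rewrite lead_coef_eq0 -size_poly_eq0 si.
by move=> j _; rewrite IH // mulr0.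
Qed.

(** The half-space is transported by the conjugation. The finite-rank operator granting
    almost-invariance is conjugated into [r] and merged with [s], while multiples of the identity
    preserve every subspace. *)
Lemma conjugate_no_almost_invariant (U T : omega R -> omega R) (lambda : K)
    (S : omega R -> omega R) :
  (forall s M, finite_rank (transp s) -> closed M ->
    invariant_for (U \+ transp s) M -> ~ half_space M) ->
  operator S -> finite_rank S -> conjugate_to T (U \+ lambda \*: idfun \+ S) ->
  ~ exists M, [/\ closed M, half_space M & almost_invariant_for T M].
Proof.
move=> noM /operator_transp[s ->] fs [P [Pinv [oP oPinv PK PinvK ->]]] {T S}.
case: (oPinv) => _ contPinv.
move: oP oPinv PK PinvK => /operator_transp[b bE] /operator_transp[c cE].
rewrite {}bE {P} => bK cK.
move=> [M [cM [sM Mi Mc] [S0 [/operator_transp[s0 ->] fs0 iM]]]].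
pose r n := lcomb c (lcomb s0 (b n)).
have rE x : transp r x = transp b (transp s0 (Pinv x)).
  by apply/funext => n; rewrite cE /transp -/(transp c x) -/(transp s0 _) !pair_transp.
have srE x : transp (fun n => s n + r n) x = transp s x + transp r x.
  by apply/funext => n; rewrite /transp linearD.
have cbK x : transp c (transp b x) = x by rewrite -cE bK.
(* As a preimage under the continuous [Pinv], the transported subspace is closed. *)
have imE : transp b @` M = Pinv @^-1` M.
  apply/seteqP; split=> [_ [x Mx <-]|x Mx] /=; first by rewrite bK.
  by exists (Pinv x).
apply: (noM (fun n => s n + r n) (transp b @` M)).
- apply: (finite_dim_sum fs (image_finite_dim (transp b) fs0)).
    by apply: image_subspace; apply/linear_subspaceP.
  move=> _ [x _ <-]; exists (transp s x); first by exists x.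
  rewrite srE addrC addKr rE; exists (transp s0 (Pinv x)) => //.
- by rewrite imE; move/continuous_closedP: contPinv; apply.
- move=> _ [_ [x Mx <-] <-]; rewrite /= srE addrA.
  have : M (Pinv ((U \+ lambda \*: idfun \+ transp s) (transp b x)) + transp s0 x).
    by apply: iM; exists x.
  move=> /(subspaceP (- lambda) sM Mx) My.
  exists (- lambda *: x + (Pinv ((U \+ lambda \*: idfun \+ transp s) (transp b x))
    + transp s0 x)) => //.
  rewrite linearP linearD /= cK rE bK scaleNr.
  by rewrite !addrA; congr (_ + _ + _); rewrite addrAC addNr add0r.
- split; first exact: image_subspace.
    move=> fM; apply: Mi; suff -> : M = transp c @` (transp b @` M).
      exact: image_finite_dim.
    rewrite image_comp (_ : transp c \o transp b = id) ?image_id //.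
    by apply/funext => x; apply: cbK.
  move=> [n [v vM]]; apply: Mc; exists n, (transp c \o v) => x.
  have [y [d yE] [z Mz zE]] := vM (transp b x).
  exists (transp c y).
    by exists d; rewrite yE linear_sum; apply: eq_bigr => i _; rewrite linearZ.
  by rewrite -[x]cbK -linearB -zE /= cbK.
Qed.

End Shifts.

Theorem theorem2 (R : realType) (T : omega R -> omega R) (hT : operator T) :
  [<->
    (* (1) *)
    ~ exists M : set (omega R),
        [/\ closed M, half_space M & almost_invariant_for T M];
    (* (2) *)
    ~ exists M : set (omega R),
        [/\ closed M, half_space M & invariant_for T M];
    (* (3) *)
    exists (lambda : Cfield R) (S : omega R -> omega R),
      [/\ operator S, finite_rank S &
        conjugate_to T (@backward_shift R \+ lambda \*: idfun \+ S) \/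
        conjugate_to T (@forward_shift R \+ lambda \*: idfun \+ S)]].
Proof.
tfae.
- move=> noM [M [cM hM iM]]; apply: noM; exists M; split=> //.
  exists (transp (fun=> 0)); split; first exact: transp_operator.
    exact: (@finite_rank_transp _ _ 0%N).
  move=> _ [x Mx <-]; apply: iM; exists x => //=.
  have -> : transp (fun=> 0) x = 0 by apply/funext => n; rewrite /transp linear0.
  by rewrite addr0.
- exact: no_half_space_conjugate.
move=> [lambda [S [oS fS []]]];
  apply: conjugate_no_almost_invariant => // s M fs cM iM [sM Mi].
- by apply; apply: contrapT => /(backward_shift_no_half_space fs cM sM iM).
- by apply; apply: (forward_shift_no_half_space fs cM sM iM).
Qed.
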